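(* Let $T=U|T|$ be the polar decomposition of $T\in\mathbb{B}(\mathcal{H})$. Then the following conditions are equivalent: (i) $T$ is binormal. (ii) $UU^{*}|T|=|T|UU^{*}$ and $U^{*}\Delta(T)$ is self-adjoint. (iii) For all $\lambda\in(0,1)$, $P_{\lambda}(T)=U|P_{\lambda}(T)|$ is the polar decomposition of $P_{\lambda}(T)$, where $|P_{\lambda}(T)|=\big((1-\lambda)|T|^{1/2}+\lambda U^{*}|T|^{1/2}U\big)^2$. (iv) For some $\lambda\in(0,1)$, $P_{\lambda}(T)=U|P_{\lambda}(T)|$ is the polar decomposition of $P_{\lambda}(T)$, where $|P_{\lambda}(T)|=\big((1-\lambda)|T|^{1/2}+\lambda U^{*}|T|^{1/2}U\big)^2$.
   Context: $\mathbb{B}(\mathcal{H})$ denotes the bounded linear operators on a complex Hilbert space $\mathcal{H}$. $T$ is binormal if $T^{*}T$ and $TT^{*}$ commute. The polar decomposition of $T\in\mathbb{B}(\mathcal{H})$ is the unique factorization $T=U|T|$, where $|T|=(T^{*}T)^{1/2}$ and $U$ is a partial isometry with $\mathcal{N}(U)=\mathcal{N}(T)$. The Duggal transform is $T^{D}=|T|U$, the Aluthge transform is $\Delta(T)=|T|^{1/2}U|T|^{1/2}$, and for $\lambda\in[0,1]$ the power mean transform is $P_{\lambda}(T)=(1-\lambda)^2T+\lambda^2T^{D}+2\lambda(1-\lambda)\Delta(T)$. In (iii) and (iv) the formula for $|P_\lambda(T)|=(P_\lambda(T)^{*}P_\lambda(T))^{1/2}$ is part of the condition. *)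

(* Defs.v *)
From HB Require Import structures.
From mathcomp Require Import all_boot all_order all_algebra.
From mathcomp Require Import sesquilinear.
From mathcomp Require Import all_classical reals topology normedtype.
From mathcomp Require Import complex.

Set Implicit Arguments.
Unset Strict Implicit.
Unset Printing Implicit Defensive.

Import Order.TTheory GRing.Theory Num.Theory.
Import numFieldNormedType.Exports.
Local Open Scope classical_set_scope.
Local Open Scope ring_scope.
Local Open Scope complex_scope.

(* The inner product is linear in its first argument and conjugate-linear in
   its second one. *)
HB.mixin Record CompleteNormedModule_isHilbert (R : realType) H
    & CompleteNormedModule R[i] H := {
  inner : {dot H for @Num.conj R[i]} ;
  innerE : forall x : H, inner x x = `|x| ^+ 2
}.

#[short(type="hilbertType")]
HB.structure Definition Hilbert (R : realType) :=
  {H of CompleteNormedModule_isHilbert R H & CompleteNormedModule R[i] H}.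

Notation "''[' x , y ]" := (inner x y) : ring_scope.

Section BoundedOperators.
Variables (R : realType) (H : hilbertType R).

Definition bounded_linear (f : H -> H) : Prop :=
  linear f /\ exists M : R[i], forall x, `|f x| <= M * `|x|.

Definition bounded_linear_pred : {pred H -> H} :=
  fun f => `[< bounded_linear f >].

Lemma bounded_linear_submod : submod_closed bounded_linear_pred.
Proof.
split=> [|a f g].
  apply/asboolP; split=> [b x y|]; first by rewrite scaler0 addr0.
  by exists 0 => x; rewrite normr0 mul0r.
move=> /asboolP[lf [M fM]] /asboolP[lg [N gN]]; apply/asboolP.
have E x : (a *: f + g) x = a *: f x + g x by [].
split=> [b x y|].
  rewrite !E lf lg !scalerDr !scalerA (mulrC a b) -!addrA; congr (_ + _).
  by rewrite addrCA.
exists (`|a| * M + N) => x.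
rewrite E (le_trans (ler_normD _ _)) // mulrDl lerD ?gN //.
by rewrite normrZ -mulrA ler_wpM2l.
Qed.

HB.instance Definition _ := GRing.isSubmodClosed.Build R[i] (H -> H)
  bounded_linear_pred bounded_linear_submod.

Record bop := Bop {
  bop_fun :> H -> H ;
  bopP : bop_fun \in bounded_linear_pred }.

HB.instance Definition _ := [isSub for bop_fun].
HB.instance Definition _ := [Choice of bop by <:].
HB.instance Definition _ := [SubChoice_isSubLmodule of bop by <:].

Lemma bop_ext (S T : bop) : S =1 T -> S = T.
Proof. by move=> ST; apply/val_inj/funext. Qed.

Lemma bop_linear (T : bop) : linear T.
Proof. by have /asboolP[] := bopP T. Qed.

Lemma bop1_subproof : (idfun : H -> H) \in bounded_linear_pred.
Proof. by apply/asboolP; split=> //; exists 1 => x; rewrite mul1r. Qed.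

Lemma bopM_subproof (S T : bop) : (S \o T) \in bounded_linear_pred.
Proof.
have /asboolP[lS [M SM]] := bopP S; have /asboolP[lT [N TN]] := bopP T.
apply/asboolP; split=> [a x y|] /=; first by rewrite lT lS.
exists (`|M| * N) => x /=; rewrite (le_trans (SM _)) //.
have [->|y0] := eqVneq `|T x| 0.
  by rewrite mulr0 -mulrA mulr_ge0 // (le_trans _ (TN x)).
have M0 : 0 <= M.
  have := le_trans (normr_ge0 _) (SM (T x)).
  by rewrite pmulr_lge0 // lt_neqAle eq_sym y0 normr_ge0.
by rewrite ger0_norm // -mulrA ler_wpM2l.
Qed.

Definition bop1 := Bop bop1_subproof.
Definition bopM (S T : bop) := Bop (bopM_subproof S T).

Let bopMA : associative bopM. Proof. by move=> *; apply: bop_ext. Qed.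
Let bop1M : left_id bop1 bopM. Proof. by move=> ?; apply: bop_ext. Qed.
Let bopM1 : right_id bop1 bopM. Proof. by move=> ?; apply: bop_ext. Qed.
Let bopMDl : left_distributive bopM +%R.
Proof. by move=> *; apply: bop_ext. Qed.
Let bopMDr : right_distributive bopM +%R.
Proof.
move=> S T1 T2; apply: bop_ext => x.
by have := bop_linear S 1 (T1 x) (T2 x); rewrite !scale1r.
Qed.

(* Only a possibly zero ring, since the zero Hilbert space is allowed. *)
HB.instance Definition _ :=
  GRing.Zmodule_isPzRing.Build bop bopMA bop1M bopM1 bopMDl bopMDr.

End BoundedOperators.

Notation "''B' ( H )" := (bop H) (format "''B' ( H )") : type_scope.

Section OperatorNotions.
Variables (R : realType) (H : hilbertType R).
Implicit Types (S T U A : 'B(H)) (l : R).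

(* The operator with this property exists by Riesz representation and is
   unique; [xget 0] selects it. *)
Definition adj T : 'B(H) :=
  xget 0 [set S : 'B(H) | forall x y, '[T x, y] = '[x, S y]].

Definition self_adjoint T : Prop := adj T = T.

Definition positive_op T : Prop := forall x, 0 <= '[T x, x].

(* The positive square root, which exists and is unique for positive [A]; it
   is only ever applied to positive operators. *)
Definition opsqrt A : 'B(H) :=
  xget 0 [set S : 'B(H) | positive_op S /\ S * S = A].

Definition opabs T : 'B(H) := opsqrt (adj T * T).

Definition binormal T : Prop := GRing.comm (adj T * T) (T * adj T).

Definition opker T : set H := [set x | T x = 0].

Definition partial_isometry U : Prop :=
  forall x, (forall y, opker U y -> '[x, y] = 0) -> `|U x| = `|x|.

Definition polar_decomposition T U : Prop :=
  [/\ T = U * opabs T, partial_isometry U & opker U = opker T].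

(* In the three transforms below, [U] is meant to be the partial isometry of
   the polar decomposition of [T], which [T] determines. *)
Definition duggal T U : 'B(H) := opabs T * U.

Definition aluthge T U : 'B(H) := opsqrt (opabs T) * U * opsqrt (opabs T).

Definition power_mean l T U : 'B(H) :=
  ((1 - l) ^+ 2)%:C *: T + (l ^+ 2)%:C *: duggal T U
  + (2 * l * (1 - l))%:C *: aluthge T U.

End OperatorNotions.

(* Main.v *)
(* Write P = |T|, Q = P^(1/2), F = UU* and W = U*QU.  Every condition amounts to
   QU = UW together with WQ = QW.  As square roots commute with whatever
   commutes with the original operator, binormality says that Q commutes with
   UQU*, which unfolds to these two equations, and (ii) is a restatement of
   them.  Given the equations, P_l(T) = U N^2 with N = (1 - l)Q + lW positive,
   hence |P_l(T)| = N^2.  Conversely, multiplying P_l(T) = U N^2 by U* gives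
   l^2 (U*Q^2U - W^2) + l(1 - l)(WQ - QW) = 0, whose self-adjoint and
   skew-adjoint parts vanish separately: WQ = QW, and U*Q(1 - F)QU = 0 means
   QU = FQU = UW. *)
Require Import Defs.
From HB Require Import structures.
From mathcomp Require Import all_boot all_order all_algebra.
From mathcomp Require Import sesquilinear ring lra.
From mathcomp Require Import all_classical reals topology normedtype.
From mathcomp Require Import complex.

Set Implicit Arguments.
Unset Strict Implicit.
Unset Printing Implicit Defensive.

Import Order.TTheory GRing.Theory Num.Theory.
Import numFieldNormedType.Exports.
Local Open Scope ring_scope.
Local Open Scope complex_scope.

HB.instance Definition _ (R : realType) (H : hilbertType R) (T : 'B(H)) :=
  GRing.isLinear.Build R[i] H H *:%R (bop_fun T) (bop_linear T).

(** * The underlying real inner product *)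

Section RealInnerProduct.
Variables (R : realType) (H : hilbertType R).
Implicit Types (x y z : H) (a : R) (c : R[i]).

(* Norms of [H] live in [R[i]]; estimates are made on real parts, which lose
   nothing by [inner_ipE]. *)
Definition ip x y : R := complex.Re '[x, y].
Definition nr x : R := complex.Re `|x|.

Lemma nrE x : `|x| = (nr x)%:C.
Proof. by rewrite /nr RRe_real // normr_real. Qed.

Lemma nr_ge0 x : 0 <= nr x.
Proof. by rewrite -ler0c -nrE. Qed.

Lemma nrD x y : nr (x + y) <= nr x + nr y.
Proof. by rewrite -lecR rmorphD /= -!nrE ler_normD. Qed.

Lemma nr0 : nr 0 = 0.
Proof. by rewrite /nr normr0. Qed.

Lemma nrN x : nr (- x) = nr x.
Proof. by rewrite /nr normrN. Qed.

Lemma nr_distC x y : nr (x - y) = nr (y - x).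
Proof. by rewrite -nrN opprB. Qed.

Lemma nr_eq0 x : nr x = 0 -> x = 0.
Proof. by move=> x0; apply/normr0_eq0; rewrite nrE x0. Qed.

Lemma nrZ a x : nr (a%:C *: x) = `|a| * nr x.
Proof.
apply: complexI; rewrite -nrE normrZ rmorphM /= -nrE normc_def /=.
by rewrite expr0n /= addr0 sqrtr_sqr.
Qed.

Lemma nrZC c x : nr (c *: x) = complex.Re `|c| * nr x.
Proof.
by rewrite {1}/nr normrZ nrE -[in LHS](RRe_real (normr_real c)) -rmorphM.
Qed.

Lemma innerC x y : '[x, y] = '[y, x]^*.
Proof. by rewrite (hermC (inner : {dot H for _})) expr0 mul1r. Qed.

Lemma ipC x y : ip x y = ip y x.
Proof. by rewrite /ip innerC; case: ('[y, x]). Qed.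

Lemma ipDl x y z : ip (x + y) z = ip x z + ip y z.
Proof. by rewrite /ip linearDl raddfD. Qed.

Lemma ipDr x y z : ip z (x + y) = ip z x + ip z y.
Proof. by rewrite ipC ipDl ![ip _ z]ipC. Qed.

Lemma ipNl x y : ip (- x) y = - ip x y.
Proof. by rewrite /ip linearNl raddfN. Qed.

Lemma ipNr x y : ip x (- y) = - ip x y.
Proof. by rewrite ipC ipNl ipC. Qed.

Lemma ipZl a x y : ip (a%:C *: x) y = a * ip x y.
Proof.
by rewrite /ip linearZl_LR /=; case: ('[x, y]) => u v /=; rewrite mul0r subr0.
Qed.

Lemma ipZr a x y : ip x (a%:C *: y) = a * ip x y.
Proof. by rewrite ipC ipZl ipC. Qed.

Lemma ipZC c x y : ip x (c *: y) = ip (c^* *: x) y.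
Proof. by rewrite /ip linearZl_LR linearZr_LR. Qed.

Lemma ip0l x : ip 0 x = 0.
Proof. by rewrite -(scale0r x) (_ : 0 = 0%:C) // ipZl mul0r. Qed.

Lemma ip0r x : ip x 0 = 0.
Proof. by rewrite ipC ip0l. Qed.

Lemma ipxx x : ip x x = nr x ^+ 2.
Proof. by rewrite /ip innerE nrE -rmorphXn. Qed.

Lemma ipBl x y z : ip (x - y) z = ip x z - ip y z.
Proof. by rewrite ipDl ipNl. Qed.

Lemma ipBr x y z : ip z (x - y) = ip z x - ip z y.
Proof. by rewrite ipDr ipNr. Qed.

Lemma inner_ipE x y : '[x, y] = ip x y +i* ip x ('i *: y).
Proof.
rewrite /ip linearZr_LR /=; case: ('[x, y]) => u v /=.
by rewrite mul0r sub0r mulN1r opprK.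
Qed.

Lemma ip_inj x y : (forall z, ip z x = ip z y) -> x = y.
Proof.
move=> xy; apply/subr0_eq/nr_eq0/eqP; rewrite -sqrf_eq0 -ipxx.
by rewrite ipBr xy subrr.
Qed.

Lemma nrB2 x y : nr (x - y) ^+ 2 = nr x ^+ 2 - 2 * ip x y + nr y ^+ 2.
Proof. by rewrite -!ipxx ipBl !ipBr (ipC y x); ring. Qed.

Lemma nrD2 x y : nr (x + y) ^+ 2 = nr x ^+ 2 + 2 * ip x y + nr y ^+ 2.
Proof. by rewrite -!ipxx ipDl !ipDr (ipC y x); ring. Qed.

(** Cauchy-Schwarz: expand the squared norm of [|y| x - |x| y] and divide by [|x| |y|], the
    degenerate cases being separate. *)
Lemma ip_le x y : ip x y <= nr x * nr y.
Proof.
have := nrB2 ((nr y)%:C *: x) ((nr x)%:C *: y).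
rewrite !nrZ !ger0_norm ?nr_ge0 // ipZl ipZr.
have := sqr_ge0 (nr ((nr y)%:C *: x - (nr x)%:C *: y)).
have [x0 _ _|x0] := eqVneq (nr x) 0.
  by rewrite (nr_eq0 x0) ip0l mulr_ge0 ?nr_ge0.
have [y0 _ _|y0] := eqVneq (nr y) 0.
  by rewrite (nr_eq0 y0) ip0r mulr_ge0 ?nr_ge0.
move=> h e; rewrite -(@ler_pM2l _ (nr x * nr y)); first by lra.
by rewrite mulr_gt0 ?lt_def ?x0 ?y0 ?nr_ge0.
Qed.

Lemma ip_norm_le x y : `|ip x y| <= nr x * nr y.
Proof.
by rewrite ler_norml ip_le lerNl -ipNl andbT -[nr x]nrN ip_le.
Qed.

(* [e] is an explicit modulus of convergence. *)
Lemma hilbert_complete (u : nat -> H) (e : nat -> R) :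
  (forall d, 0 < d -> exists n, e n < d) ->
  (forall n m, (n <= m)%N -> nr (u m - u n) <= e n) ->
  exists l, forall n, nr (l - u n) <= e n.
Proof.
move=> e0 ue.
have cu : cvg (u @ \oo)%classic.
  apply/cauchy_cvgP/cauchy_ballP => eps eps0.
  have re : eps = (complex.Re eps)%:C by rewrite RRe_real // gtr0_real.
  have d0 : 0 < complex.Re eps / 2 by rewrite divr_gt0 // -ltcR -re.
  have [n en] := e0 _ d0.
  pose A := [set v | exists2 k, (n <= k)%N & v = u k]%classic.
  exists (A, A); first by split; exists n => // k nk; exists k.
  case=> v w [/= [k nk ->] [m nm ->]]; rewrite -ball_normE /ball_ /= re nrE ltcR.
  rewrite (_ : u k - u m = (u k - u n) + (u n - u m)); last first.
    by rewrite addrA subrK.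
  apply: (le_lt_trans (nrD _ _)); rewrite (nr_distC (u n)).
  by have := ue _ _ nk; have := ue _ _ nm; lra.
exists (lim (u @ \oo))%classic => n.
(* The bound passes to the limit up to a slack [d], through a common index beyond both [n] and
   [m]. *)
apply/ler_addgt0Pr => d d0.
have /cvgrPdist_lt /(_ d%:C) := cu; rewrite ltcR => /(_ d0)[m _ um].
have /um := leq_maxr n m; rewrite nrE ltcR => h.
have := ue _ _ (leq_maxl n m).
have := nrD (lim (u @ \oo)%classic - u (maxn n m)) (u (maxn n m) - u n).
by rewrite addrA subrK; lra.
Qed.

End RealInnerProduct.

(** * Riesz representation and adjoints *)

(** Archimedean substitute for letting [n] tend to infinity; dividing by [C + 1] allows [C = 0]. *)
Lemma ge0_of_harmonic (R : realType) (a C : R) :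
  0 <= C -> (forall n, - (C * n.+1%:R^-1) <= a) -> 0 <= a.
Proof.
move=> C0 h; rewrite leNgt; apply/negP => a0.
have k0 : 0 < - a / (C + 1) by rewrite divr_gt0; lra.
have [n] := ltr_add_invr k0; rewrite add0r ltr_pdivlMr; last by lra.
have := h n; have : 0 < n.+1%:R^-1 :> R by rewrite invr_gt0.
by set w := _^-1; nra.
Qed.

(** At [t = - r / (a + 1)] the quadratic is a negative multiple of [r ^+ 2]; [a + 1] in place of [a]
    covers [a = 0]. *)
Lemma quadratic_ge0 (R : realType) (a r : R) :
  0 <= a -> (forall t, 0 <= t ^+ 2 * a + 2 * t * r) -> r = 0.
Proof.
move=> a0 /(_ (- r / (a + 1))).
have -> : (- r / (a + 1)) ^+ 2 * a + 2 * (- r / (a + 1)) * r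
  = - (r ^+ 2 * (a + 2) / (a + 1) ^+ 2).
  by field; apply/eqP; lra.
rewrite oppr_ge0 pmulr_lle0; last by rewrite invr_gt0 exprn_gt0; lra.
rewrite pmulr_lle0; last lra.
by move=> h; apply/eqP; rewrite -sqrf_eq0 eq_le h sqr_ge0.
Qed.

Section Adjoint.
Variables (R : realType) (H : hilbertType R).
Implicit Types (x y z : H) (a : R) (c : R[i]) (S T : 'B(H)).

(* [z] minimizes [nr x ^+ 2 - 2 * f x]; minimizing sequences are Cauchy by the
   parallelogram identity. *)
Lemma riesz (f : H -> R) (M : R) :
  (forall x y, f (x + y) = f x + f y) ->
  (forall a x, f (a%:C *: x) = a * f x) ->
  (forall x, f x <= M * nr x) ->
  exists z, forall h, ip h z = f h.
Proof.
move=> fD fZ fM.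
pose J x := nr x ^+ 2 - 2 * f x.
pose A := [set J x | x in [set: H]]%classic.
pose w n : R := n.+1%:R^-1.
have w0 n : 0 < w n by rewrite invr_gt0.
have w1 n : w n <= 1 by rewrite invf_le1 // ler1n.
have Ai : has_inf A.
  split; first by exists (J 0), 0.
  exists (- M ^+ 2) => _ [x _ <-]; rewrite /J.
  by have := fM x; have := sqr_ge0 (nr x - M); lra.
have mJ x : inf A <= J x by apply: ge_inf; [exact: Ai.2|exists x].
(* The tolerance is a square because the parallelogram identity, applied at the midpoint of [u m]
   and [u n], controls squared distances. *)
have /choice[u uJ] n : exists x, J x < inf A + w n ^+ 2.
  have [_ [x _ <-] Jx] := inf_adherent (exprn_gt0 2 (w0 n)) Ai.
  by exists x.
have [z uz] : exists z, forall n, nr (z - u n) <= 2 * w n.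
  apply: (@hilbert_complete _ _ u (fun n => 2 * w n)) => [d d0|n m nm].
    have d20 : 0 < d / 2 by rewrite divr_gt0.
    have [n] := ltr_add_invr d20; rewrite add0r => nd; exists n.
    by move: nd; rewrite -/(w n); lra.
  have wmn : w m <= w n by rewrite lef_pV2 ?posrE // ler_nat.
  have wmn2 : w m ^+ 2 <= w n ^+ 2 by rewrite ler_sqr ?nnegrE //; apply: ltW.
  rewrite -ler_sqr ?nnegrE ?nr_ge0 ?mulr_ge0 ?ltW // nrB2.
  have := mJ (2^-1%:C *: (u m + u n)).
  have := uJ n; have := uJ m; rewrite /J.
  rewrite fZ fD nrZ exprMn nrD2 ger0_norm ?invr_ge0 //.
  by lra.
exists z => h; apply/eqP; rewrite -subr_eq0; apply/eqP.
apply: (@quadratic_ge0 _ (nr h ^+ 2)) => [|t]; first exact: sqr_ge0.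
(* First variation of [J] at [u n] in the direction [h]. The term [4 |t| |h|] pays for replacing [z]
   by [u n], and [1] pays for the defect [w n ^+ 2 <= w n]. *)
apply: (@ge0_of_harmonic _ _ (4 * `|t| * nr h + 1)) => [|n].
  by rewrite addr_ge0 // !mulr_ge0 ?nr_ge0.
have := mJ (u n + t%:C *: h); have := uJ n.
rewrite /J nrD2 fD fZ nrZ exprMn -normrX (ger0_norm (sqr_ge0 t)) ipZr (ipC (u n)).
have -> : ip h z = ip h (u n) + ip h (z - u n) by rewrite ipBr; ring.
have : `|t * ip h (z - u n)| <= `|t| * (nr h * (2 * w n)).
  rewrite normrM ler_wpM2l // (le_trans (ip_norm_le _ _)) //.
  by rewrite ler_wpM2l ?nr_ge0.
rewrite ler_norml => /andP[h1 _]; rewrite -/(w n).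
have := w1 n; have := w0 n.
by move: h1; nra.
Qed.

Lemma bopf0 T : T 0 = 0. Proof. exact: linear0. Qed.

Lemma bopfD T x y : T (x + y) = T x + T y. Proof. exact: linearD. Qed.

Lemma bopfB T x y : T (x - y) = T x - T y. Proof. exact: linearB. Qed.

Lemma bopfZ T c x : T (c *: x) = c *: T x. Proof. exact: linearZ. Qed.

Lemma bop_bounded T : exists2 M : R, 0 <= M & forall x, nr (T x) <= M * nr x.
Proof.
have /asboolP[_ [M TM]] := bopP T.
exists (complex.Re `|M|) => [|x]; first by rewrite -ler0c RRe_real ?normr_real.
rewrite -lecR rmorphM /= RRe_real ?normr_real // -!nrE.
have := TM x => h; apply: (le_trans h).
by rewrite -(ger0_norm (le_trans (normr_ge0 _) h)) normrM normr_id.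
Qed.

Lemma bounded_linear_of_real (S : H -> H) (M : R) :
  linear S -> (forall x, nr (S x) <= M * nr x) -> S \in @bounded_linear_pred R H.
Proof.
move=> lS SM; apply/asboolP; split=> //; exists M%:C => x.
by rewrite !nrE -rmorphM lecR.
Qed.

(** Riesz representation of [h => ip (T h) y] for each [y]; boundedness comes from
    [|S x|^2 = ip (T (S x)) x]. *)
Lemma adjoint_exists T : exists S : 'B(H), forall x y, ip (T x) y = ip x (S y).
Proof.
have [M M0 TM] := bop_bounded T.
have /choice[S TS] y : exists z, forall h, ip h z = ip (T h) y.
  apply: (@riesz _ (M * nr y)) => [x x'|a x|x].
  - by rewrite bopfD ipDl.
  - by rewrite bopfZ ipZl.
  - by rewrite (le_trans (ip_le _ _)) // mulrAC ler_wpM2r ?nr_ge0.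
have lS : linear S.
  move=> c x y; apply: ip_inj => h.
  rewrite ipDr TS ipDr -[ip (T h) y]TS; congr (_ + _).
  by rewrite !ipZC TS bopfZ.
have SM x : nr (S x) <= M * nr x.
  have [->|S0] := eqVneq (nr (S x)) 0; first by rewrite mulr_ge0 ?nr_ge0.
  rewrite -(@ler_pM2l _ (nr (S x))) ?lt_def ?S0 ?nr_ge0 //.
  rewrite -expr2 -ipxx TS (le_trans (ip_le _ _)) //.
  by rewrite mulrCA mulrA ler_wpM2r ?nr_ge0.
by exists (Bop (bounded_linear_of_real lS SM)) => x y /=; rewrite TS.
Qed.

(** The default of [xget] is never taken: a real adjoint that is complex linear is also a complex
    adjoint, by [inner_ipE]. *)
Lemma adj_inner T x y : '[T x, y] = '[x, adj T y].
Proof.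
suff : [set S : 'B(H) | forall x y, '[T x, y] = '[x, S y]]%classic (adj T) by [].
have [S TS] := adjoint_exists T; apply: (@xgetPex _ 0); exists S => u v.
by rewrite !inner_ipE !TS bopfZ.
Qed.

Lemma adjP T x y : ip (T x) y = ip x (adj T y).
Proof. by rewrite /ip adj_inner. Qed.

Lemma adjP' T x y : ip (adj T x) y = ip x (T y).
Proof. by rewrite ipC -adjP ipC. Qed.

Lemma bop0E x : (0 : 'B(H)) x = 0.
Proof. by []. Qed.

Lemma bopDE S T x : (S + T) x = S x + T x.
Proof. by []. Qed.

Lemma bopNE S x : (- S) x = - S x.
Proof. by []. Qed.

Lemma bopME S T x : (S * T) x = S (T x).
Proof. by []. Qed.

Lemma bopZE c S x : (c *: S) x = c *: S x.
Proof. by []. Qed.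

Lemma adj_uniq T S : (forall x y, ip (T x) y = ip x (S y)) -> adj T = S.
Proof.
by move=> TS; apply: bop_ext => y; apply: ip_inj => x; rewrite -adjP TS.
Qed.

Lemma adjK T : adj (adj T) = T.
Proof. by apply: adj_uniq => x y; rewrite adjP'. Qed.

Lemma adjM S T : adj (S * T) = adj T * adj S.
Proof. by apply: adj_uniq => x y; rewrite /= !adjP. Qed.

Lemma adjD S T : adj (S + T) = adj S + adj T.
Proof. by apply: adj_uniq => x y; rewrite ipDl ipDr !adjP. Qed.

Lemma adjN T : adj (- T) = - adj T.
Proof. by apply: adj_uniq => x y; rewrite ipNl ipNr !adjP. Qed.

Lemma adj_scale a T : adj (a%:C *: T) = a%:C *: adj T.
Proof. by apply: adj_uniq => x y; rewrite ipZl ipZr !adjP. Qed.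

Lemma adj_one : adj (1 : 'B(H)) = 1.
Proof. by apply: adj_uniq. Qed.

Lemma scalerMl c S T : (c *: S) * T = c *: (S * T).
Proof. exact: bop_ext. Qed.

Lemma scalerMr c S T : S * (c *: T) = c *: (S * T).
Proof. by apply: bop_ext => x; rewrite /= bopfZ. Qed.

End Adjoint.

(** * Square roots of positive operators *)

Section SquareRoot.
Variables (R : realType) (H : hilbertType R).
Implicit Types (x y z : H) (a : R) (c : R[i]) (S T A B C : 'B(H)).

(** Over the complex numbers, reality of the quadratic form already forces self-adjointness, by
    polarization. *)
Lemma positive_opP A :
  positive_op A <-> adj A = A /\ forall x, 0 <= ip (A x) x.
Proof.
split=> [pA|[sA pA] x]; last first.
  rewrite lecE /= eq_sym; apply/andP; split; last exact: pA.
  have: complex.Im '[A x, x] = - complex.Im '[A x, x].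
    by rewrite {1}adj_inner sA innerC; case: ('[A x, x]).
  by move=> h; apply/eqP; lra.
split=> [|x]; last first.
  by rewrite -ler0c (le_trans (pA x)) // lecE /= eq_sym ger0_Im // !eqxx lexx.
have im0 x : ip (A x) ('i *: x) = 0.
  by have := ger0_Im (pA x); rewrite inner_ipE.
apply: adj_uniq => x w.
(* With this [v], the cross terms of [im0 (x + v)] are [ip (A x) w] and [- ip x (A w)]. *)
pose v := - 'i *: w.
have iv : 'i *: v = w by rewrite scalerA mulrN -expr2 sqr_i opprK scale1r.
have Av : ip (A v) ('i *: x) = - ip x (A w).
  rewrite ipZC bopfZ scalerA (_ : _ * _ = -1) ?scaleN1r ?ipNl 1?ipC //.
  by rewrite mulrN; simpc.
have := im0 (x + v); rewrite bopfD scalerDr ipDl !ipDr iv Av.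
by have := im0 x; have := im0 v; rewrite iv; lra.
Qed.

Lemma positive_adj A : positive_op A -> adj A = A.
Proof. by case/positive_opP. Qed.

Lemma positive_ip A x : positive_op A -> 0 <= ip (A x) x.
Proof. by case/positive_opP. Qed.

Lemma positive_conj S A : positive_op A -> positive_op (adj S * A * S).
Proof.
case/positive_opP => sA pA; apply/positive_opP; split=> [|x].
  by rewrite !adjM adjK sA mulrA.
by rewrite /= adjP' pA.
Qed.

Lemma positive_sqr S : adj S = S -> positive_op (S * S).
Proof.
move=> sS; apply/positive_opP; split=> [|x]; first by rewrite adjM sS.
by rewrite /= adjP sS ipxx sqr_ge0.
Qed.

Lemma positive_gram T : positive_op (adj T * T).
Proof.
apply/positive_opP; split=> [|x]; first by rewrite adjM adjK.
by rewrite /= adjP' ipxx sqr_ge0.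
Qed.

Lemma positiveD A B : positive_op A -> positive_op B -> positive_op (A + B).
Proof.
move=> /positive_opP[sA pA] /positive_opP[sB pB]; apply/positive_opP.
by split=> [|x]; rewrite ?adjD ?sA ?sB // ipDl addr_ge0 ?pA ?pB.
Qed.

Lemma positiveZ a A : 0 <= a -> positive_op A -> positive_op (a%:C *: A).
Proof.
move=> a0 /positive_opP[sA pA]; apply/positive_opP.
by split=> [|x]; rewrite ?adj_scale ?sA // ipZl mulr_ge0 ?pA.
Qed.

(* Expand [0 <= ip (B y) y] at [y = x - B x]. *)
Lemma positive_contraction B x : positive_op B ->
  (forall y, ip (B y) y <= nr y ^+ 2) -> nr (B x) <= nr x.
Proof.
move=> /positive_opP[sB pB] B1.
rewrite -ler_sqr ?nnegrE ?nr_ge0 //.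
have := pB (x - B x); have := B1 x; have := B1 (B x).
rewrite bopfB ipBl !ipBr (adjP B (B x) x) sB (ipxx (B x)).
by lra.
Qed.

(* The scalar majorant of the iteration [sqrt_iter]: it solves
   [1 - d_(n+1) = (1 + (1 - d_n)^2) / 2]. *)
Fixpoint sqrt_rate n : R :=
  if n is m.+1 then sqrt_rate m - sqrt_rate m ^+ 2 / 2 else 1.

(** Induction: [t - t^2 / 2] increases on [0, 1], and at [t = 2 / k] it equals [2 (k - 1) / k^2],
    which is at most [2 / (k + 1)]. *)
Lemma sqrt_rate_bound n : 0 <= sqrt_rate n <= 2 / n.+2%:R.
Proof.
elim: n => [|n /andP[d0 dn]]; first by rewrite /= ler01 divff ?lexx ?pnatr_eq0.
set d := sqrt_rate n in d0 dn *.
have -> : sqrt_rate n.+1 = d - d ^+ 2 / 2 by [].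
have n2 : n.+2%:R >= 2 :> R by rewrite ler_nat.
have -> : n.+3%:R = n.+2%:R + 1 :> R by rewrite -natr1.
move: dn n2; move: (n.+2%:R : R) => k dn k2.
have k0 : 0 < k by lra.
have dk : d * k <= 2 by rewrite -ler_pdivlMr.
have d1 : d <= 1 by nra.
apply/andP; split; first by nra.
rewrite ler_pdivlMr; last by lra.
set e := 2 / k in dn.
have ek : e * k = 2 by rewrite /e divfK // gt_eqF.
have e0 : 0 < e by rewrite divr_gt0.
have e1 : e <= 1 by nra.
have h : d - d ^+ 2 / 2 <= e - e ^+ 2 / 2 by nra.
apply: (@le_trans _ _ ((e - e ^+ 2 / 2) * (k + 1))).
  by rewrite ler_wpM2r //; lra.
by nra.
Qed.

Lemma sqrt_rate_ge0 n : 0 <= sqrt_rate n.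
Proof. by case/andP: (sqrt_rate_bound n). Qed.

Lemma sqrt_rate_le1 n : sqrt_rate n <= 1.
Proof.
case/andP: (sqrt_rate_bound n) => _ h; apply: (le_trans h).
by rewrite ler_pdivrMr ?ltr0n // mul1r ler_nat.
Qed.

Lemma sqrt_rate_le n m : (n <= m)%N -> sqrt_rate m <= sqrt_rate n.
Proof.
elim: m => [|m IH]; first by rewrite leqn0 => /eqP->.
rewrite leq_eqVlt => /predU1P[->//|/IH h]; apply: le_trans h => /=.
by have := sqr_ge0 (sqrt_rate m); lra.
Qed.

Lemma sqrt_rate_harmonic n : sqrt_rate n <= 2 * n.+1%:R^-1.
Proof.
case/andP: (sqrt_rate_bound n) => _ h; apply: (le_trans h).
by rewrite ler_pM2l // lef_pV2 ?posrE ?ltr0n // ler_nat.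
Qed.

Lemma nr_rate0 x (K : R) : 0 <= K -> (forall n, nr x <= K * sqrt_rate n) -> x = 0.
Proof.
move=> K0 h; apply: nr_eq0; apply/eqP; rewrite eq_le nr_ge0 andbT -oppr_ge0.
apply: (@ge0_of_harmonic _ _ (K * 2)) => [|n]; first by rewrite mulr_ge0.
rewrite lerN2 (le_trans (h n)) // -mulrA ler_wpM2l //.
exact: sqrt_rate_harmonic.
Qed.

(** A fixed point satisfies [2 Y = B + Y^2], that is [(1 - Y)^2 = 1 - B]. *)
Fixpoint sqrt_iter B n : 'B(H) :=
  if n is m.+1 then 2^-1%:C *: (B + sqrt_iter B m * sqrt_iter B m) else 0.

Lemma sqrt_iter_comm B C n : C * B = B * C ->
  C * sqrt_iter B n = sqrt_iter B n * C.
Proof.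
move=> CB; elim: n => [|n IH] /=; first by rewrite mulr0 mul0r.
by rewrite scalerMr scalerMl mulrDr mulrDl CB mulrA IH -!mulrA IH.
Qed.

Lemma sqrt_iter_adj B n : adj B = B -> adj (sqrt_iter B n) = sqrt_iter B n.
Proof.
move=> sB; elim: n => [|n IH] /=.
  by apply: adj_uniq => x y; rewrite ip0l ip0r.
by rewrite adj_scale adjD adjM IH sB.
Qed.

(** * Convergence of the iteration for a contraction *)

Section Iteration.
Variable B : 'B(H).
Hypothesis B1 : forall x, nr (B x) <= nr x.

Let Y := sqrt_iter B.
Let d := sqrt_rate.

Lemma sqrt_iter_norm n x : nr (Y n x) <= (1 - d n) * nr x.
Proof.
elim: n x => [|n IH] x.
  by have -> : Y 0 x = 0 by []; rewrite /d /= subrr mul0r nr0.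
have -> : Y n.+1 x = 2^-1%:C *: (B x + Y n (Y n x)) by [].
rewrite nrZ ger0_norm ?invr_ge0 //.
have := nrD (B x) (Y n (Y n x)); have := B1 x; have := IH (Y n x).
have := IH x; have := sqrt_rate_le1 n.
have -> : d n.+1 = d n - d n ^+ 2 / 2 by [].
rewrite -/(d n); move: (d n) => e e1 h1 h2 h3 h4.
have : (1 - e) * nr (Y n x) <= (1 - e) * ((1 - e) * nr x).
  by rewrite ler_wpM2l // subr_ge0.
by lra.
Qed.

(** The iterates commute, so each increment is the previous one multiplied by half the sum of two
    consecutive iterates. The scalars [1 - d n] obey the same recursion and dominate. *)
Lemma sqrt_iter_step n x :
  nr (Y n.+1 x - Y n x) <= (d n - d n.+1) * nr x.
Proof.
elim: n x => [|n IH] x.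
  have -> : Y 1 x - Y 0 x = 2^-1%:C *: B x.
    have -> : Y 1 x = 2^-1%:C *: (B x + Y 0 (Y 0 x)) by [].
    by have Y0 z : Y 0 z = 0 by []; rewrite !Y0 subr0 addr0.
  rewrite nrZ ger0_norm ?invr_ge0 // /d /=; have := B1 x; lra.
have -> : Y n.+2 x - Y n.+1 x =
    2^-1%:C *: ((Y n.+1 (Y n.+1 x - Y n x)) + Y n (Y n.+1 x - Y n x)).
  have YY : Y n (Y n.+1 x) = Y n.+1 (Y n x).
    have h m : Y m * B = B * Y m by symmetry; apply: sqrt_iter_comm.
    have := sqrt_iter_comm n.+1 (h n) => /(congr1 (fun S : 'B(H) => S x)).
    by [].
  have -> : Y n.+2 x - Y n.+1 x = 2^-1%:C *: (B x + Y n.+1 (Y n.+1 x)) -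
    2^-1%:C *: (B x + Y n (Y n x)) by [].
  move: (Y n.+1) (Y n) YY => S T TS.
  rewrite -scalerBr !bopfB TS; congr (_ *: _); apply: ip_inj => z.
  by rewrite !(ipDr, ipNr); ring.
rewrite nrZ ger0_norm ?invr_ge0 //.
have := nrD (Y n.+1 (Y n.+1 x - Y n x)) (Y n (Y n.+1 x - Y n x)).
have := sqrt_iter_norm n.+1 (Y n.+1 x - Y n x).
have := sqrt_iter_norm n (Y n.+1 x - Y n x).
have := IH x; have := sqrt_rate_le1 n; have := sqrt_rate_le1 n.+1.
have -> : d n.+2 = d n.+1 - d n.+1 ^+ 2 / 2 by [].
rewrite -/(d n) -/(d n.+1); have : d n.+1 = d n - d n ^+ 2 / 2 by [].
move: (d n) (d n.+1) => e f -> h1 h2 h3 h4 h5 h6.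
move: h3 h4 h5 h6; set v := nr (_ - _) => h3 h4 h5 h6.
have : (2 - e - (e - e ^+ 2 / 2)) * v <=
    (2 - e - (e - e ^+ 2 / 2)) * ((e - (e - e ^+ 2 / 2)) * nr x).
  by rewrite ler_wpM2l //; lra.
by lra.
Qed.

Lemma sqrt_iter_cauchy n m x : (n <= m)%N ->
  nr (Y m x - Y n x) <= (d n - d m) * nr x.
Proof.
elim: m => [|m IH].
  by rewrite leqn0 => /eqP->; rewrite !subrr mul0r nr0.
rewrite leq_eqVlt => /predU1P[->|/IH h].
  by rewrite !subrr mul0r nr0.
have := nrD (Y m.+1 x - Y m x) (Y m x - Y n x); rewrite addrA subrK.
by have := sqrt_iter_step m x; lra.
Qed.

Lemma sqrt_iter_lim : exists Y' : 'B(H),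
  forall n x, nr (Y' x - Y n x) <= d n * nr x.
Proof.
have /choice[L YL] x : exists l, forall n, nr (l - Y n x) <= d n * nr x.
  apply: hilbert_complete => [e e0|n m nm].
    have k0 : 0 < e / (2 * (nr x + 1)).
      by rewrite divr_gt0 // mulr_gt0 //; have := nr_ge0 x; lra.
    have [n] := ltr_add_invr k0; rewrite add0r.
    rewrite ltr_pdivlMr; last by have := nr_ge0 x; lra.
    move=> h; exists n; have := sqrt_rate_harmonic n; rewrite -/(d n).
    have := sqrt_rate_ge0 n; rewrite -/(d n).
    by have := nr_ge0 x; move: h; move: (n.+1%:R^-1) => w; nra.
  apply: (le_trans (sqrt_iter_cauchy x nm)).
  rewrite ler_wpM2r ?nr_ge0 //; have := sqrt_rate_ge0 m; rewrite -/(d m); lra.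
have lL : linear L.
  move=> c x y; apply/eqP; rewrite -subr_eq0; apply/eqP.
  apply: (@nr_rate0 _ (nr (c *: x + y) + complex.Re `|c| * nr x + nr y)).
    by rewrite !addr_ge0 ?mulr_ge0 ?nr_ge0 // -ler0c RRe_real ?normr_real.
  move=> n; rewrite -/(d n).
  (* As [Y n] is linear, the defect of linearity of [L] is a combination of three approximation
     errors. *)
  have -> : L (c *: x + y) - (c *: L x + L y) =
    (L (c *: x + y) - Y n (c *: x + y)) - (c *: (L x - Y n x)) - (L y - Y n y).
    rewrite bopfD bopfZ scalerBr; apply: ip_inj => z.
    by rewrite !(ipDr, ipNr); ring.
  apply: (le_trans (nrD _ _)); rewrite nrN.
  have := nrD (L (c *: x + y) - Y n (c *: x + y)) (- (c *: (L x - Y n x))).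
  rewrite nrN nrZC.
  have c0 : 0 <= complex.Re `|c| by rewrite -ler0c RRe_real ?normr_real.
  have := ler_wpM2l c0 (YL x n); have := YL y n; have := YL (c *: x + y) n.
  lra.
have LM x : nr (L x) <= 1 * nr x.
  (* At index 0 the iterate is [0] and the rate is [1], so the limit is a contraction. *)
  by have := YL x 0%N; rewrite /Y /= subr0.
by exists (Bop (bounded_linear_of_real lL LM)) => n x /=.
Qed.

End Iteration.

End SquareRoot.

(** * Existence and uniqueness of positive square roots *)

Section SquareRootExists.
Variables (R : realType) (H : hilbertType R).
Implicit Types (x y z : H) (a : R) (c : R[i]) (S T A B C : 'B(H)).

Lemma bop_eq0 S (K : H -> R) : (forall x, 0 <= K x) ->
  (forall n x, nr (S x) <= K x * sqrt_rate R n) -> S = 0.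
Proof. by move=> K0 h; apply: bop_ext => x; apply: (nr_rate0 (K0 x)). Qed.

Lemma bop_eq S T (K : H -> R) : (forall x, 0 <= K x) ->
  (forall n x, nr (S x - T x) <= K x * sqrt_rate R n) -> S = T.
Proof. by move=> K0 h; apply: subr0_eq; apply: (bop_eq0 K0) => n x; apply: h. Qed.

(* [1 - Y] is the root: the limit [Y] of the iteration solves
   [2 Y = B + Y^2]. *)
Lemma sqrt_exists_contraction B :
  adj B = B -> (forall x, nr (B x) <= nr x) ->
  exists2 S : 'B(H), positive_op S /\ S * S = 1 - B &
    forall C, C * B = B * C -> C * S = S * C.
Proof.
move=> sB B1; have [Y YB] := sqrt_iter_lim B1.
have d0 := sqrt_rate_ge0 R.
have Y1 x : nr (Y x) <= nr x.
  by have := YB 0%N x; rewrite (_ : sqrt_iter B 0 x = 0) // subr0 mul1r.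
have sY : adj Y = Y.
  apply: adj_uniq => x y; apply/eqP; rewrite -subr_eq0; apply/eqP.
  have h n : ip (Y x) y - ip x (Y y) =
      ip (Y x - sqrt_iter B n x) y - ip x (Y y - sqrt_iter B n y).
    by rewrite ipBl ipBr (adjP (sqrt_iter B n)) sqrt_iter_adj //; ring.
  have {}h n : `|ip (Y x) y - ip x (Y y)| <= 4 * (nr x * nr y) * n.+1%:R^-1.
    have := ip_norm_le (Y x - sqrt_iter B n x) y.
    have := ip_norm_le x (Y y - sqrt_iter B n y).
    have := ler_wpM2r (nr_ge0 y) (YB n x).
    have := ler_wpM2l (nr_ge0 x) (YB n y).
    have := ler_normB (ip (Y x - sqrt_iter B n x) y)
                      (ip x (Y y - sqrt_iter B n y)).
    have := ler_wpM2l (mulr_ge0 (nr_ge0 x) (nr_ge0 y)) (sqrt_rate_harmonic R n).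
    by rewrite (h n); move: (n.+1%:R^-1) => w; lra.
  apply/eqP; rewrite -normr_eq0 eq_le normr_ge0 andbT -oppr_ge0.
  apply: (@ge0_of_harmonic _ _ (4 * (nr x * nr y))) => [|n].
    by rewrite !mulr_ge0 ?nr_ge0.
  by rewrite lerN2.
have Y2 : Y + Y = B + Y * Y.
  apply: (@bop_eq _ _ (fun x => 4 * nr x)) => [x|n x].
    by rewrite mulr_ge0 ?nr_ge0.
  set Z := sqrt_iter B.
  (* Replacing [Y] by iterates on both sides leaves only errors, since [2 Z n.+1 = B + Z n ^ 2]
     exactly; together they are at most [4 * sqrt_rate R n * nr x]. *)
  have e : (Y + Y) x - (B + Y * Y) x = (Y x - Z n.+1 x) + (Y x - Z n.+1 x)
     - (Y (Y x - Z n x) + (Y (Z n x) - Z n (Z n x))).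
    have -> : Z n.+1 x = 2^-1%:C *: (B x + Z n (Z n x)) by [].
    rewrite bopfB; apply: ip_inj => z.
    by rewrite !bopDE !bopME !(ipDr, ipNr, ipZr); field.
  rewrite e; apply: (le_trans (nrD _ _)); rewrite nrN.
  have := nrD (Y x - Z n.+1 x) (Y x - Z n.+1 x).
  have := nrD (Y (Y x - Z n x)) (Y (Z n x) - Z n (Z n x)).
  have := Y1 (Y x - Z n x); have := YB n x; have := YB n.+1 x.
  have := YB n (Z n x); rewrite -!/Z.
  have := ler_wpM2l (d0 n) (sqrt_iter_norm B1 n x); rewrite -/Z.
  have := ler_wpM2r (nr_ge0 x) (sqrt_rate_le R (leqnSn n)).
  have := mulr_ge0 (mulr_ge0 (d0 n) (d0 n)) (nr_ge0 x).
  by lra.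
exists (1 - Y) => [|C CB].
  split; last first.
    have -> : B = Y + Y - Y * Y by rewrite Y2 addrK.
    rewrite mulrBl mul1r mulrBr mulr1 !opprB opprD -!addrA.
    by congr (1 + _); rewrite addrCA.
  apply/positive_opP; split=> [|x]; first by rewrite adjD adjN adj_one sY.
  rewrite bopDE bopNE ipBl subr_ge0 ipxx (le_trans (ip_le _ _)) //.
  by rewrite expr2 ler_wpM2r ?nr_ge0.
have [M M0 CM] := bop_bounded C.
suff CY : C * Y = Y * C by rewrite mulrBl mulrBr mul1r mulr1 CY.
apply: (@bop_eq _ _ (fun x => M * nr x + nr (C x))) => [x|n x].
  by rewrite addr_ge0 ?mulr_ge0 ?nr_ge0.
set Z := sqrt_iter B n.
(* The iterates commute with [C], so the commutator with the limit is again made of two errors. *)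
have -> : (C * Y) x - (Y * C) x = C (Y x - Z x) - (Y (C x) - Z (C x)).
  have := sqrt_iter_comm n CB; rewrite -/Z.
  move=> /(congr1 (fun S : 'B(H) => S x)); rewrite /= => CZ.
  rewrite bopfB CZ; apply: ip_inj => z.
  by rewrite ?bopME !(ipDr, ipNr); ring.
apply: (le_trans (nrD _ _)); rewrite nrN.
have := CM (Y x - Z x); have := ler_wpM2l M0 (YB n x).
by have := YB n (C x); rewrite -/Z; lra.
Qed.

(** The factor is a square so that the root of the rescaled operator can be scaled back by
    [k^-1]. *)
Lemma bop_contracting_scale A :
  exists2 k : R, 0 < k & forall x, ip ((k ^+ 2)%:C *: A x) x <= nr x ^+ 2.
Proof.
have [M M0 AM] := bop_bounded A.
exists (M + 1)^-1 => [|x]; first by rewrite invr_gt0; lra.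
rewrite ipZl; have := ip_le (A x) x; have := ler_wpM2r (nr_ge0 x) (AM x).
move=> h1 h2; have h : ip (A x) x <= M * nr x ^+ 2 by lra.
have k0 : 0 < (M + 1) ^+ 2 by rewrite exprn_gt0 //; lra.
rewrite exprVn mulrC ler_pdivrMr //; apply: (le_trans h).
by rewrite mulrC ler_wpM2l ?sqr_ge0 //; nra.
Qed.

(** After rescaling, [B = 1 - k^2 A] lies between [0] and [1], hence is a contraction, and
    [1 - B = k^2 A]. *)
Lemma sqrt_exists A : positive_op A ->
  exists2 S : 'B(H), positive_op S /\ S * S = A &
    forall C, C * A = A * C -> C * S = S * C.
Proof.
move=> pA; have [k k0 Ak] := bop_contracting_scale A.
have pkA : positive_op ((k ^+ 2)%:C *: A) by apply: positiveZ => //; apply: sqr_ge0.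
pose B := 1 - (k ^+ 2)%:C *: A.
have sB : adj B = B by rewrite adjD adjN adj_one (positive_adj pkA).
have pB : positive_op B.
  apply/positive_opP; split=> // x.
  by rewrite bopDE bopNE ipBl subr_ge0 ipxx; apply: Ak.
have [x|S [pS SS] CS] := sqrt_exists_contraction sB.
  apply: (positive_contraction _ pB) => y.
  by rewrite bopDE bopNE ipBl ipxx gerBl (positive_ip _ pkA).
have k1 : k^-1%:C * k^-1%:C * (k ^+ 2)%:C = 1 :> R[i].
  by rewrite -!rmorphM /= expr2 -invfM mulVf ?mulf_neq0 ?gt_eqF.
exists (k^-1%:C *: S).
  split; first by apply: positiveZ => //; rewrite invr_ge0 ltW.
  by rewrite scalerMl scalerMr scalerA SS /B subKr scalerA k1 scale1r.
move=> C CA; rewrite scalerMl scalerMr CS // /B mulrBl mulrBr mul1r mulr1.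
by rewrite scalerMl scalerMr CA.
Qed.

(** With a self-adjoint root [S] of [A], the form [ip (A x) x] is [|S x|^2]. *)
Lemma positive_ip0 A x : positive_op A -> ip (A x) x = 0 -> A x = 0.
Proof.
move=> /sqrt_exists[S [pS SS] _] h.
suff Sx : S x = 0 by rewrite -SS bopME Sx bopf0.
apply: nr_eq0; apply/eqP; rewrite -sqrf_eq0 -ipxx.
by rewrite adjP (positive_adj pS) -bopME SS ipC h.
Qed.

(* If [T] commutes with [S] and has the same square, then [(S + T) (S - T) = 0],
   so both [S] and [T] vanish on the range of [S - T]. *)
Lemma sqrt_unique_comm S T : positive_op S -> positive_op T ->
  S * T = T * S -> S * S = T * T -> S = T.
Proof.
move=> pS pT ST SSTT; apply: subr0_eq; apply: bop_ext => x; apply: nr_eq0.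
set D := S - T; set y := D x.
have y0 : S y + T y = 0.
  rewrite -bopDE -bopME /D mulrBr !mulrDl SSTT ST.
  by rewrite (addrC (T * T)) subrr.
have : ip (S y) y + ip (T y) y = 0 by rewrite -ipDl y0 ip0l.
move=> h; have := positive_ip y pS; have := positive_ip y pT => hT hS.
have Sy : S y = 0 by apply: positive_ip0 => //; lra.
have Ty : T y = 0 by apply: positive_ip0 => //; lra.
apply/eqP; rewrite -sqrf_eq0 -ipxx -/y {1}/y adjP adjD adjN.
by rewrite (positive_adj pS) (positive_adj pT) bopDE bopNE Sy Ty subrr ip0r.
Qed.

(** The root chosen by [xget] commutes with its own square [A], hence with the constructed root [S],
    so uniqueness among commuting roots identifies the two. *)
Lemma opsqrt_spec A : positive_op A ->
  [/\ positive_op (opsqrt A), opsqrt A * opsqrt A = A &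
      forall C, C * A = A * C -> C * opsqrt A = opsqrt A * C].
Proof.
move=> pA; have [S [pS SS] CS] := sqrt_exists pA.
have [pQ QQ] : [set S : 'B(H) | positive_op S /\ S * S = A]%classic (opsqrt A).
  by apply: (@xgetPex _ 0); exists S.
suff e : opsqrt A = S by rewrite e; split.
apply: sqrt_unique_comm => //; last by rewrite QQ SS.
by apply: CS; rewrite -{2 3}QQ mulrA.
Qed.

Lemma opsqrt_uniq A S : positive_op S -> S * S = A -> opsqrt A = S.
Proof.
move=> pS SS; have pA : positive_op A.
  by rewrite -SS; apply/positive_sqr/positive_adj.
have [pQ QQ QC] := opsqrt_spec pA.
apply: sqrt_unique_comm => //; last by rewrite QQ SS.
by symmetry; apply: QC; rewrite -SS mulrA.
Qed.

Lemma positive_ker_sqr A x : positive_op A -> A (A x) = 0 -> A x = 0.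
Proof.
move=> pA h; apply: nr_eq0; apply/eqP; rewrite -sqrf_eq0 -ipxx.
by rewrite adjP (positive_adj pA) h ip0r.
Qed.

End SquareRootExists.

(** * Polar decompositions and power means *)

Section PolarDecomposition.
Variables (R : realType) (H : hilbertType R).
Implicit Types (x y z : H) (S T U V A B C D Q W : 'B(H)).

Lemma comm_sqrt S C : positive_op S -> C * (S * S) = S * S * C -> C * S = S * C.
Proof.
move=> pS; have e := opsqrt_uniq pS (erefl (S * S)).
by have [_ _ /(_ C)] := opsqrt_spec (positive_sqr (positive_adj pS)); rewrite e.
Qed.

Lemma comm_sqrt2 S T : positive_op S -> positive_op T ->
  GRing.comm (S * S) (T * T) -> GRing.comm S T.
Proof.
move=> pS pT /(comm_sqrt pT) /esym /(comm_sqrt pS) h.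
exact/esym.
Qed.

Lemma opabs_spec T : positive_op (opabs T) /\ opabs T * opabs T = adj T * T.
Proof. by have [] := opsqrt_spec (positive_gram T). Qed.

Lemma opabs_eq0 T x : (opabs T x = 0) <-> (T x = 0).
Proof.
have [pP PP] := opabs_spec T.
have e : nr (opabs T x) = nr (T x).
  apply/eqP; rewrite -(@eqrXn2 _ 2) ?nr_ge0 // -!ipxx.
  by rewrite adjP (positive_adj pP) -bopME PP bopME -adjP.
by split=> h; apply: nr_eq0; [rewrite -e|rewrite e]; rewrite h nr0.
Qed.

(** The self-adjoint [G = adj U * U - 1] preserves the orthogonal complement of the kernel of [U],
    and its quadratic form vanishes there. Evaluating the form at [x + G x] leaves
    [2 |G x|^2 = 0]. *)
Lemma partial_isometry_gram U x : partial_isometry U ->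
  (forall y, U y = 0 -> '[x, y] = 0) -> adj U (U x) = x.
Proof.
move=> iU xU; pose G := adj U * U - 1.
have sG : adj G = G by rewrite adjD adjN adj_one adjM adjK.
have G0 z : (forall y, U y = 0 -> '[z, y] = 0) -> ip (G z) z = 0.
  move=> zU; rewrite bopDE bopNE bopME ipBl adjP' !ipxx (_ : nr (U z) = nr z).
    by rewrite subrr.
  by rewrite /nr (iU z).
have GU y : U y = 0 -> '[G x, y] = 0.
  move=> y0; rewrite adj_inner sG bopDE bopNE bopME y0 bopf0 sub0r.
  by apply: xU; rewrite -scaleN1r bopfZ y0 scaler0.
have xG y : U y = 0 -> '[x + G x, y] = 0.
  by move=> y0; rewrite linearDl /= xU // GU // addr0.
have GE : adj U (U x) - x = G x by [].
clearbody G; have := G0 _ xG; rewrite bopfD ipDl !ipDr (G0 x) //.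
rewrite (adjP G (G x) x) sG (G0 (G x)) // => h; apply/subr0_eq/nr_eq0/eqP.
by rewrite GE -sqrf_eq0 -ipxx; apply/eqP; lra.
Qed.

(** The range of [adj U] is orthogonal to the kernel of [U], where [adj U * U] acts as the
    identity. *)
Lemma partial_isometryK U x : partial_isometry U -> U (adj U (U x)) = U x.
Proof.
move=> iU; apply/subr0_eq/nr_eq0/eqP; rewrite -sqrf_eq0 -ipxx -bopfB.
rewrite -adjP' !bopfB (partial_isometry_gram iU (x := adj U (U x))).
  by rewrite subrr ip0l.
by move=> y y0; rewrite adj_inner adjK y0 linear0r.
Qed.

(** A self-adjoint operator that kills the kernel of [U] has its range in the orthogonal complement;
    the second identity is the adjoint of the first. *)
Lemma partial_isometry_support U S : partial_isometry U -> adj S = S ->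
  (forall x, U x = 0 -> S x = 0) ->
  (forall x, adj U (U (S x)) = S x) /\ (forall x, S (adj U (U x)) = S x).
Proof.
move=> iU sS kS.
have US x : adj U (U (S x)) = S x.
  apply: (partial_isometry_gram iU) => y /kS y0.
  by rewrite adj_inner sS y0 linear0r.
split=> // x; apply: ip_inj => z.
by rewrite -{1}sS -!adjP -adjP' US adjP sS.
Qed.

Lemma power_mean_factor (l : R) U Q W :
  (forall x, Q (U x) = U (W x)) -> (forall x, W (Q x) = Q (W x)) ->
  ((1 - l) ^+ 2)%:C *: (U * (Q * Q)) + (l ^+ 2)%:C *: (Q * Q * U)
    + (2 * l * (1 - l))%:C *: (Q * U * Q)
  = U * (((1 - l)%:C *: Q + l%:C *: W) * ((1 - l)%:C *: Q + l%:C *: W)).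
Proof.
move=> QU WQ; apply: bop_ext => x.
rewrite !bopDE !bopZE !bopME !bopDE !bopZE !bopfD !bopfZ.
rewrite !bopfD !bopfZ !QU WQ; apply: ip_inj => z.
by rewrite !(ipDr, ipZr); ring.
Qed.

(** The [Q^2] terms cancel, and [2 W Q] against [W Q + Q W] leaves a commutator. *)
Lemma power_mean_compress (l : R) U V Q W :
  (forall x, V (U (Q x)) = Q x) -> (forall x, V (Q (U x)) = W x) ->
  V * (((1 - l) ^+ 2)%:C *: (U * (Q * Q)) + (l ^+ 2)%:C *: (Q * Q * U)
    + (2 * l * (1 - l))%:C *: (Q * U * Q))
  = ((1 - l)%:C *: Q + l%:C *: W) * ((1 - l)%:C *: Q + l%:C *: W) ->
  (l ^+ 2)%:C *: (V * (Q * Q) * U - W * W)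
  + (l * (1 - l))%:C *: (W * Q - Q * W) = 0.
Proof.
move=> VUQ VQU e; apply: bop_ext => x; apply: ip_inj => z.
have := congr1 (fun S : 'B(H) => ip z (S x)) e; rewrite bop0E ip0r.
rewrite !(bopDE, bopNE, bopZE, bopME) !(bopfD, bopfZ) !VUQ !VQU.
by rewrite !(ipDr, ipZr, ipNr); lra.
Qed.

(** Taking adjoints flips the sign of the [D] term only; add and subtract the two equations. *)
Lemma skew_sum_eq0 (a b : R) A D : a != 0 -> b != 0 ->
  adj A = A -> adj D = - D -> a%:C *: A + b%:C *: D = 0 -> A = 0 /\ D = 0.
Proof.
move=> a0 b0 sA sD e.
have e1 x z : a * ip z (A x) + b * ip z (D x) = 0.
  have := congr1 (fun S : 'B(H) => ip z (S x)) e.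
  by rewrite bopDE !bopZE ipDr !ipZr bop0E ip0r.
have e2 x z : a * ip z (A x) - b * ip z (D x) = 0.
  have := e1 z x; rewrite -!(adjP' _ z) ipC sA [ip x _]ipC sD bopNE ipNl.
  by rewrite mulrN opprK.
split; apply: bop_ext => x; apply: ip_inj => z; rewrite bop0E ip0r.
  by apply: (mulfI a0); have := e1 x z; have := e2 x z; lra.
by apply: (mulfI b0); have := e1 x z; have := e2 x z; lra.
Qed.

(** * The conditions for a fixed polar decomposition *)

Section Polar.
Variables T U : 'B(H).
Hypothesis TU : polar_decomposition T U.

Let P := opabs T.
Let Q := opsqrt P.
Let V := adj U.
Let W := V * Q * U.

Let TE x : T x = U (P x).
Proof. by case: TU => e _ _; rewrite {1}e. Qed.

Let iU : partial_isometry U. Proof. by case: TU. Qed.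

Let pP : positive_op P. Proof. by case: (opabs_spec T). Qed.

Let pQ : positive_op Q. Proof. by case: (opsqrt_spec pP). Qed.

Let QQ x : Q (Q x) = P x.
Proof. by case: (opsqrt_spec pP) => _ e _; rewrite -bopME e. Qed.

Let kerUP x : U x = 0 <-> P x = 0.
Proof.
rewrite opabs_eq0; case: TU => _ _ /predeqP /(_ x); exact.
Qed.

Let kerUQ x : U x = 0 -> Q x = 0.
Proof. by move/kerUP => h; apply: positive_ker_sqr => //; rewrite QQ. Qed.

Let VUQ x : V (U (Q x)) = Q x.
Proof. by have [h _] := partial_isometry_support iU (positive_adj pQ) kerUQ. Qed.

Let QVU x : Q (V (U x)) = Q x.
Proof. by have [_ h] := partial_isometry_support iU (positive_adj pQ) kerUQ. Qed.

Let UVU x : U (V (U x)) = U x. Proof. exact: partial_isometryK. Qed.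

Let VUV x : V (U (V x)) = V x.
Proof.
apply: ip_inj => z.
by rewrite -adjP -adjP' -adjP UVU adjP.
Qed.

Let pW : positive_op W. Proof. exact: positive_conj. Qed.

Let WE x : V (Q (U x)) = W x. Proof. by []. Qed.

Let VUW x : V (U (W x)) = W x. Proof. by rewrite -WE VUV. Qed.

Let adjT : adj T = P * V.
Proof.
have -> : T = U * P by apply: bop_ext => x; rewrite TE.
by rewrite adjM (positive_adj pP).
Qed.

Let gramT : adj T * T = P * P.
Proof. by case: (opabs_spec T). Qed.

(** This is the square root of the modulus of [adj T]: [L^2 = U P V] and [L^4 = T * adj T]. *)
Let L := U * Q * V.

Let pL : positive_op L.
Proof. by rewrite /L -{1}[U]adjK; apply: positive_conj. Qed.

Let LLE x : L (L x) = U (P (V x)).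
Proof. by rewrite !bopME VUQ QQ. Qed.

Let cogramT : T * adj T = (L * L) * (L * L).
Proof.
apply: bop_ext => x; rewrite adjT !bopME TE.
rewrite -![U (Q (V _))]/(L _) !LLE.
by rewrite -(QQ (V _)) VUQ QQ.
Qed.

Let PQ : P = Q * Q. Proof. by apply: bop_ext => x; rewrite -QQ. Qed.

(** Here [adj T * T = Q^4] and [T * adj T = L^4], so two rounds of root extraction give the forward
    direction. *)
Lemma binormal_comm : binormal T <-> GRing.comm Q L.
Proof.
rewrite /binormal gramT cogramT; split=> [h|h].
  apply: comm_sqrt2 => //; apply: comm_sqrt2; rewrite -?PQ //.
  exact/positive_sqr/positive_adj.
have hL : GRing.comm Q (L * L * (L * L)) by do 2! apply: commrM.
by rewrite PQ; apply: commr_sym; do 2! apply: commrM; apply: commr_sym.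
Qed.

(* Both conditions express that [Q] is reduced by the range of [U] and that its
   compression to this range, transported by [U], commutes with [Q]. *)
Let core := (forall x, Q (U x) = U (W x)) /\ (forall x, W (Q x) = Q (W x)).

Lemma comm_reduced : GRing.comm Q L ->
  U * V * P = P * U * V /\ self_adjoint (V * aluthge T U).
Proof.
move=> QL.
have QLx x : Q (L x) = L (Q x) by rewrite -!bopME QL.
have PL x : P (L x) = L (P x) by rewrite -!QQ !QLx.
(* With [F = U V], this says [F P (1 - F) = 0]: [L] kills [y = (1 - F) x], hence also [P y], which
   gives [Q (V (P y)) = 0]. *)
have FPF x : U (V (P x)) = U (V (P (U (V x)))).
  apply/subr0_eq; rewrite -!bopfB; set y := x - U (V x).
  have Ly : L y = 0 by rewrite !bopME bopfB VUV subrr !bopf0.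
  apply/kerUP; rewrite -(QQ (V _)).
  have : L (P y) = 0 by rewrite -PL Ly bopf0.
  rewrite !bopME => /(congr1 V); rewrite VUQ bopf0 => ->.
  by rewrite bopf0.
(* Adjoint of [FPF]; together they give [F P = P F]. *)
have PF x : P (U (V x)) = U (V (P (U (V x)))).
  apply: ip_inj => z; rewrite -!adjP' !(positive_adj pP).
  by rewrite -![adj V]/(adj (adj U)) !adjK -/V -FPF.
split.
  by apply: bop_ext => x; rewrite !bopME FPF -PF.
rewrite /self_adjoint /aluthge -/P -/Q !adjM adjK (positive_adj pQ).
apply: bop_ext => x; rewrite !bopME -/V.
(* Evaluated at [U x], commutation reads [Q U Q x = U Q V Q U x]; applying [V] gives [W Q = Q W]. *)
have := QLx (U x); rewrite !bopME QVU => ->.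
by rewrite VUQ.
Qed.

(** The root [Q] inherits commutation with [U V] from [P]; moreover [V * aluthge T U] is [W * Q],
    with adjoint [Q * W]. *)
Lemma reduced_core :
  U * V * P = P * U * V -> self_adjoint (V * aluthge T U) -> core.
Proof.
move=> FP sA; split=> x.
  have [_ _ /(_ (U * V))] := opsqrt_spec pP; rewrite mulrA => /(_ FP) FQ.
  by have := congr1 (fun S : 'B(H) => S (U x)) FQ; rewrite /= UVU => <-.
move: sA; rewrite /self_adjoint /aluthge -/P -/Q !adjM adjK (positive_adj pQ).
by move=> /(congr1 (fun S : 'B(H) => S x)).
Qed.

Lemma core_comm : core -> GRing.comm Q L.
Proof.
move=> [QU WQ]; apply: bop_ext => x; rewrite !bopME QU WQ; congr (U (Q _)).
(* What remains is [W V = V Q], the adjoint of [Q U = U W]. *)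
rewrite -WE; apply: ip_inj => z.
by rewrite -!adjP -!adjP' !adjK !(positive_adj pQ) QU VUW.
Qed.

Lemma power_meanE (l : R) : power_mean l T U =
  ((1 - l) ^+ 2)%:C *: (U * (Q * Q)) + (l ^+ 2)%:C *: (Q * Q * U)
  + (2 * l * (1 - l))%:C *: (Q * U * Q).
Proof. by rewrite -PQ; case: TU => {1}<-. Qed.

Let N (l : R) := (1 - l)%:C *: Q + l%:C *: W.

Let pN l : 0 < l < 1 -> positive_op (N l).
Proof.
case/andP=> l0 l1; apply: positiveD; apply: positiveZ => //; lra.
Qed.

Let VUN l x : V (U (N l x)) = N l x.
Proof. by rewrite bopDE !bopZE !bopfD !bopfZ VUQ VUW. Qed.

Lemma core_power_mean (l : R) : 0 < l < 1 -> core ->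
  polar_decomposition (power_mean l T U) U /\
  opabs (power_mean l T U) = N l ^+ 2.
Proof.
move=> l01 [QU WQ].
have e : power_mean l T U = U * (N l * N l).
  by rewrite power_meanE (power_mean_factor l QU WQ).
have sN := positive_adj (pN l01).
have VN : V * U * N l = N l by apply: bop_ext => x; rewrite !bopME VUN.
have a : opabs (power_mean l T U) = N l * N l.
  apply: opsqrt_uniq; first exact: positive_sqr.
  by rewrite e !adjM sN -!mulrA (mulrA V U) (mulrA (V * U)) VN.
split; last by rewrite a expr2.
split=> //; first by rewrite a.
rewrite e; apply/seteqP; split=> x h.
  have {}h : U x = 0 by [].
  have Qx := kerUQ h; apply: (_ : (U * (N l * N l)) x = 0); rewrite !bopME.
  by rewrite [N l x]bopDE !bopZE -WE h Qx !bopf0 !scaler0 addr0 !bopf0.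
have {}h : U (N l (N l x)) = 0 by [].
have Nx : N l x = 0.
  apply: (positive_ker_sqr (pN l01)).
  by rewrite -VUN h bopf0.
apply/kerUP; rewrite -QQ; suff -> : Q x = 0 by rewrite bopf0.
(* Two nonnegative terms sum to zero, and the weight [1 - l] is positive, so [ip (Q x) x = 0]. *)
have := congr1 (fun y => ip y x) Nx; rewrite bopDE !bopZE ipDl !ipZl ip0l.
have := positive_ip x pQ; have := positive_ip x pW => hW hQ hh.
apply: (positive_ip0 pQ); move: l01 => /andP[l0 l1].
have : 0 <= (1 - l) * ip (Q x) x by rewrite mulr_ge0 //; lra.
have : 0 <= l * ip (W x) x by rewrite mulr_ge0 //; lra.
move=> h1 h2; have /eqP : (1 - l) * ip (Q x) x = 0 by lra.
by rewrite mulf_eq0 => /orP[/eqP|/eqP//]; lra.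
Qed.

(* Multiplying by [V], the equation [power_mean l T U = U * N l ^+ 2] becomes
   [l^2 A + l (1 - l) D = 0] with [A] self-adjoint and [D] skew-adjoint. *)
Lemma power_mean_core (l : R) : 0 < l < 1 ->
  power_mean l T U = U * N l ^+ 2 -> core.
Proof.
case/andP=> l0 l1 e; have sQ := positive_adj pQ; have sW := positive_adj pW.
pose A := V * (Q * Q) * U - W * W; pose D := W * Q - Q * W.
have sWW : adj (W * W) = W * W by rewrite (adjM W W) sW.
have sA : adj A = A by rewrite adjD adjN sWW !adjM adjK sQ mulrA.
have sD : adj D = - D by rewrite adjD adjN (adjM W) (adjM Q) sQ sW opprB.
have AD : (l ^+ 2)%:C *: A + (l * (1 - l))%:C *: D = 0.
  apply: (power_mean_compress (U := U)) => //.
  rewrite -power_meanE e expr2; apply: bop_ext => x.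
  by rewrite !bopME VUN.
have [||A0 D0] := skew_sum_eq0 _ _ sA sD AD.
- by rewrite sqrf_eq0 gt_eqF.
- by rewrite mulf_neq0 ?subr_eq0 ?gt_eqF.
split=> x; last by apply/subr0_eq; have := congr1 (fun S : 'B(H) => S x) D0.
(* With [w = Q (U x)] and [U (W x) = U (V w)], the squared distance is [|w|^2 - |V w|^2], which is
   [ip (A x) x]. *)
apply/subr0_eq/nr_eq0/eqP; rewrite -sqrf_eq0 nrB2 -WE.
set w := Q (U x); rewrite -!ipxx.
have -> : ip w (U (V w)) = ip (V w) (V w) by rewrite -adjP'.
have -> : ip (U (V w)) (U (V w)) = ip (V w) (V w) by rewrite -adjP' VUV.
have -> : ip w w = ip (V (Q (Q (U x)))) x by rewrite adjP' {2}/w adjP sQ.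
have -> : ip (V w) (V w) = ip (W (W x)) x.
  by rewrite [RHS](adjP W) sW -WE.
have := congr1 (fun S : 'B(H) => ip (S x) x) A0.
rewrite bopDE bopNE !bopME ipBl ip0l => h; apply/eqP; lra.
Qed.

End Polar.

End PolarDecomposition.

Theorem theorem3p5 (R : realType) (H : hilbertType R) (T U : 'B(H))
    (TU : polar_decomposition T U) :
  let C (l : R) :=
    polar_decomposition (power_mean l T U) U /\
    opabs (power_mean l T U) =
      ((1 - l)%:C *: opsqrt (opabs T)
       + l%:C *: (adj U * opsqrt (opabs T) * U)) ^+ 2 in
  [<-> binormal T;
       U * adj U * opabs T = opabs T * U * adj U /\
         self_adjoint (adj U * aluthge T U);
       forall l : R, 0 < l < 1 -> C l;
       exists2 l : R, 0 < l < 1 & C l].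
Proof.
move=> C; tfae.
- by move=> /(binormal_comm TU) /(comm_reduced TU).
- by move=> [FP sA] l l01; apply: core_power_mean => //; apply: reduced_core.
- move=> h; have l01 : 0 < (2^-1 : R) < 1 by apply/andP; split; lra.
  by exists 2^-1; last exact: h.
- move=> [l l01 [[e _ _] a]]; apply/(binormal_comm TU)/core_comm => //.
  by apply: (power_mean_core TU l01); rewrite {1}e a.
Qed.
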